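(* Let $(r_i)_{i\ge1}$ be a Rademacher sequence and let $(H,\langle\cdot,\cdot\rangle)$ be a (real or complex) Hilbert space with norm $\|\cdot\|$. For any $n\ge1$ and any vectors $(a_i)_{i=1}^n$ from $H$ it holds that \[\mathbb{P}\Big(\Big\|\sum_{i=1}^n r_i a_i\Big\|\le\Big(\sum_{i=1}^n\|a_i\|^2\Big)^{\frac12}\Big)\ \ge\ \frac{2\sqrt3-3}{15}\ >\ \frac{3}{100}\] and \[\mathbb{P}\Big(\Big\|\sum_{i=1}^n r_i a_i\Big\|\ge\Big(\sum_{i=1}^n\|a_i\|^2\Big)^{\frac12}\Big)\ \ge\ \frac{2\sqrt3-3}{15}\ >\ \frac{3}{100}.\]
   Context: A Rademacher sequence is a sequence of independent random variables $(r_i)_{i\ge1}$ with $\mathbb{P}(r_i=1)=\mathbb{P}(r_i=-1)=\tfrac12$. *)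

(* Defs.v *)
From HB Require Import structures.
From mathcomp Require Import all_boot all_order all_algebra finmap.
From mathcomp Require Import all_classical all_reals all_analysis.
From mathcomp Require Import complex.

Set Implicit Arguments.
Unset Strict Implicit.
Unset Printing Implicit Defensive.

Import Order.TTheory GRing.Theory Num.Theory.
Import numFieldNormedType.Exports.

Local Open Scope classical_set_scope.
Local Open Scope ring_scope.

Section Rademacher.
Context d (T : measurableType d) (R : realType) (P : probability T R).

Definition independent_RVs (I : choiceType) (X : I -> {RV P >-> R}) : Prop :=
  forall (J : {fset I}) (A : I -> set R),
    (forall j, j \in J -> measurable (A j)) ->
    P (\bigcap_(j in [set` J]) (X j @^-1` A j)) =
      (\prod_(j <- J) P (X j @^-1` A j))%E.

Definition rademacher_sequence (r : nat -> {RV P >-> R}) : Prop :=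
  [/\ independent_RVs r,
      forall i, P [set t | r i t = 1] = (1 / 2)%:E &
      forall i, P [set t | r i t = -1] = (1 / 2)%:E].

End Rademacher.

(* A Hilbert space is a complete normed module whose norm comes from an inner
   product [ip].  The forms [{dot H for theta}] are linear on the left and
   [theta]-linear on the right; [theta] is [idfun] over the reals [R] and
   [conjC] over the complex numbers [R[i]]. *)
Definition norm_induced_by (K : numFieldType) (theta : K -> K)
    (H : normedModType K) (ip : {dot H for theta}) : Prop :=
  forall x : H, `|x| ^+ 2 = ip x x.

Definition real_hilbert (R : realType) (H : completeNormedModType R)
    (ip : {dot H for idfun}) : Prop :=
  norm_induced_by ip.

Definition complex_hilbert (R : realType) (H : completeNormedModType R[i])
    (ip : {dot H for (@Num.conj R[i])}) : Prop :=
  norm_induced_by ip.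

(* Main.v *)
Require Import Defs.
From HB Require Import structures.
From mathcomp Require Import all_boot all_order all_algebra finmap.
From mathcomp Require Import all_classical all_reals all_analysis.
From mathcomp Require Import complex.
From mathcomp Require Import measurable_realfun ring lra.

(** Put X = |sum r_i a_i|^2 - sum |a_i|^2.  Expanding the inner product, the
    diagonal terms cancel because r_i^2 = 1, so X is a homogeneous Rademacher
    chaos of order two: a real combination of the products r_i r_j with i <> j
    (in the complex case only the real parts of the inner products enter).  The
    two events are X <= 0 and X >= 0, and they are exchanged by negating the
    coefficients, so it is enough to bound the probability of X <= 0 from below.

    Such an X has mean zero and satisfies E X^4 <= 15 (E X^2)^2
    ([avg_chaos_pow4]).  The constant 15 is what the Gaussian case suggests, and
    it is reached by induction on the number of signs.  Splitting off one sign
    e, X = A + e L with A a chaos and L a linear form in the other signs, hence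
    E X^4 = E A^4 + 6 E A^2 L^2 + E L^4, and it is enough to know
    E L^4 <= 3 (E L^2)^2 ([avg_lin_sqr_mul]) and
    E A^2 L^2 <= 5 E A^2 E L^2 ([avg_chaos_lin]), which are proved by the same
    splitting.

    A mean-zero variable cannot be positive with overwhelming probability when
    its fourth moment is controlled: with w^2 = 10 E X^2, the quartic
    - 2 w^3 x + 3 w^2 x^2 - x^4 is nonpositive for x > 0 and at most
    (9 + 6 sqrt 3) / 4 * w^4 for x <= 0 ([quartic_le_indic]).  Averaging this
    over X leaves 15 (E X^2)^2 as a lower bound on the left, and
    P(X <= 0) >= 15 * 4 / (100 (9 + 6 sqrt 3)) = (2 sqrt 3 - 3) / 15
    ([avg_fourth_moment]).

    The moments are computed as plain averages over finite lists of signs;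
    [prob_ge_avg] carries the result to the given probability space, using that
    the event of a prescribed list of n signs has probability 2^-n. *)

Set Implicit Arguments.
Unset Strict Implicit.
Unset Printing Implicit Defensive.

Import Order.TTheory GRing.Theory Num.Theory.
Import numFieldNormedType.Exports.

Local Open Scope classical_set_scope.
Local Open Scope ring_scope.

(** * Averages over signs and moments of chaoses of order two *)

Section SignAverage.
Variable R : realType.
Implicit Types (f g : seq R -> R) (b d : nat -> R) (c : nat -> nat -> R).

(** The expectation of [f] at a list of [n] independent uniform signs.  Lists are
    built from the head, so that the recursion splits off the first sign and
    forms on lists can ignore the length. *)
Fixpoint avg n f : R :=
  if n is m.+1 then (avg m (fun s => f (1 :: s)) + avg m (fun s => f (-1 :: s))) / 2
  else f [::].

Lemma eq_avg n f g : f =1 g -> avg n f = avg n g.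
Proof. by move=> fg; congr avg; apply/funext. Qed.

Lemma avgD n f g : avg n (fun s => f s + g s) = avg n f + avg n g.
Proof. by elim: n f g => [//|n IH] f g /=; rewrite !IH; field. Qed.

Lemma avgZ n k f : avg n (fun s => k * f s) = k * avg n f.
Proof. by elim: n f => [//|n IH] f /=; rewrite !IH; field. Qed.

Lemma avg_cst n k : avg n (fun=> k) = k.
Proof. by elim: n => [//|n IH] /=; rewrite !IH; field. Qed.

Lemma avgS n f : avg n.+1 f = avg n (fun s => (f (1 :: s) + f (-1 :: s)) / 2).
Proof.
rewrite (_ : (fun s => (f (1 :: s) + f (-1 :: s)) / 2) =
             (fun s => 2^-1 * (f (1 :: s) + f (-1 :: s)))).
  by rewrite avgZ avgD mulrC.
by apply/funext => s; rewrite mulrC.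
Qed.

Lemma le_avg n f g : (forall s, f s <= g s) -> avg n f <= avg n g.
Proof.
elim: n f g => [|n IH] f g fg //=; apply: ler_wpM2r; first by rewrite invr_ge0.
by apply: lerD; apply: IH.
Qed.

Lemma avg_ge0 n f : (forall s, 0 <= f s) -> 0 <= avg n f.
Proof. by move=> f0; rewrite -(avg_cst n 0); apply: le_avg. Qed.

Definition lin b s : R := \sum_(i < size s) b i * s`_i.

(** Subtracting the Kronecker delta removes the diagonal on lists of signs while
    keeping, on arbitrary lists, the plain difference between the quadratic form
    of [c] and its trace: this expression is then literally the random variable
    to be compared with 0, even where some [r i t] is not a sign. *)
Definition chaos c s : R :=
  \sum_(i < size s) \sum_(j < size s) c i j * (s`_i * s`_j - (i == j)%:R).

Definition shift b i := b i.+1.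
(** Coefficients of the linear form that multiplies the first sign. *)
Definition coupling c i := c 0%N i.+1 + c i.+1 0%N.
Definition shift2 c i j := c i.+1 j.+1.

Lemma lin_cons b x s : lin b (x :: s) = b 0%N * x + lin (shift b) s.
Proof. by rewrite /lin /= big_ord_recl. Qed.

Lemma chaos_cons c x s : x ^+ 2 = 1 ->
  chaos c (x :: s) = x * lin (coupling c) s + chaos (shift2 c) s.
Proof.
move=> x2; rewrite /chaos /= big_ord_recl big_ord_recl /= -expr2 x2 subrr mulr0.
rewrite add0r; under [X in _ + X]eq_bigr => i _ do rewrite big_ord_recl /=.
rewrite big_split /= addrA; congr (_ + _); rewrite -big_split /= mulr_sumr.
by apply: eq_bigr => i _; rewrite /coupling !subr0; ring.
Qed.

Lemma sqrN1 : (-1) ^+ 2 = 1 :> R. Proof. by rewrite sqrrN expr1n. Qed.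

Lemma avg_lin_mulS n b d :
  avg n.+1 (fun s => lin b s * lin d s) =
  avg n (fun s => lin (shift b) s * lin (shift d) s) + b 0%N * d 0%N.
Proof.
rewrite avgS -[b 0%N * _](avg_cst n) -avgD.
by apply: eq_avg => s; rewrite !lin_cons; field.
Qed.

Lemma avg_lin_sqrS n b :
  avg n.+1 (fun s => lin b s ^+ 2) =
  avg n (fun s => lin (shift b) s ^+ 2) + b 0%N ^+ 2.
Proof. exact: avg_lin_mulS. Qed.

Lemma avg_chaos n c : avg n (chaos c) = 0.
Proof.
elim: n c => [|n IH] c; first by rewrite /= /chaos big_ord0.
rewrite avgS -(IH (shift2 c)); apply: eq_avg => s.
by rewrite !chaos_cons ?sqrN1 ?expr1n//; field.
Qed.

Lemma avg_chaos_sqrS n c :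
  avg n.+1 (fun s => chaos c s ^+ 2) =
  avg n (fun s => chaos (shift2 c) s ^+ 2) + avg n (fun s => lin (coupling c) s ^+ 2).
Proof.
rewrite avgS -avgD; apply: eq_avg => s.
by rewrite !chaos_cons ?sqrN1 ?expr1n//; field.
Qed.

(** The value for Gaussian variables, by Wick's formula; for signs the terms
    [b i ^+ 2 * d i ^+ 2] are counted too often, whence only an inequality. *)
Lemma avg_lin_sqr_mul n b d :
  avg n (fun s => lin b s ^+ 2 * lin d s ^+ 2) <=
  avg n (fun s => lin b s ^+ 2) * avg n (fun s => lin d s ^+ 2) +
  2 * avg n (fun s => lin b s * lin d s) ^+ 2.
Proof.
elim: n b d => [|n IH] b d; first by rewrite /= /lin !big_ord0; lra.
rewrite avg_lin_mulS !avg_lin_sqrS avgS.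
set b' := shift b; set d' := shift d; have {IH} := IH b' d'.
set x := b 0%N; set y := d 0%N.
have -> : avg n (fun s => (lin b (1 :: s) ^+ 2 * lin d (1 :: s) ^+ 2 +
    lin b (-1 :: s) ^+ 2 * lin d (-1 :: s) ^+ 2) / 2) =
  avg n (fun s => lin b' s ^+ 2 * lin d' s ^+ 2) +
  x ^+ 2 * avg n (fun s => lin d' s ^+ 2) +
  y ^+ 2 * avg n (fun s => lin b' s ^+ 2) +
  4 * x * y * avg n (fun s => lin b' s * lin d' s) + x ^+ 2 * y ^+ 2.
  rewrite -!avgZ -[x ^+ 2 * y ^+ 2](avg_cst n) -!avgD.
  by apply: eq_avg => s; rewrite !lin_cons -/b' -/d' -/x -/y; field.
set m := avg n (fun s => lin b' s * lin d' s).
set B := avg n (fun s => lin b' s ^+ 2); set D := avg n (fun s => lin d' s ^+ 2).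
by move=> ?; nra.
Qed.

(** Cauchy-Schwarz, by induction: the new cross term is controlled by the mean of
    the square of [y * lin (shift b) - x * lin (shift d)]. *)
Lemma avg_lin_CS n b d :
  avg n (fun s => lin b s * lin d s) ^+ 2 <=
  avg n (fun s => lin b s ^+ 2) * avg n (fun s => lin d s ^+ 2).
Proof.
elim: n b d => [|n IH] b d; first by rewrite /= /lin !big_ord0; lra.
rewrite avg_lin_mulS !avg_lin_sqrS.
have := IH (shift b) (shift d).
set x := b 0%N; set y := d 0%N; set m := avg n _; set B := avg n _.
set D := avg n _ => mBD.
suff : 0 <= y ^+ 2 * B + - 2 * x * y * m + x ^+ 2 * D by nra.
rewrite -!avgZ -!avgD; apply: avg_ge0 => s.
by have := sqr_ge0 (y * lin (shift b) s - x * lin (shift d) s); nra.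
Qed.

(** The variance of a product of two linear forms.  Centering the product, rather
    than bounding its raw second moment by [3], yields the factor [2] that makes
    the constant [5] of [avg_chaos_lin] stable under induction. *)
Lemma avg_lin_mul_var n b d :
  avg n (fun s => (lin b s * lin d s - avg n (fun s => lin b s * lin d s)) ^+ 2)
  <= 2 * (avg n (fun s => lin b s ^+ 2) * avg n (fun s => lin d s ^+ 2)).
Proof.
set m := avg n (fun s => lin b s * lin d s).
have -> : avg n (fun s => (lin b s * lin d s - m) ^+ 2) =
    avg n (fun s => lin b s ^+ 2 * lin d s ^+ 2) - m ^+ 2.
  have -> : - m ^+ 2 = - 2 * m * m + m ^+ 2 by ring.
  rewrite addrA -[m ^+ 2](avg_cst n) {3}/m -avgZ -!avgD.
  by apply: eq_avg => s; ring.
have := avg_lin_CS n b d; have := avg_lin_sqr_mul n b d; rewrite -/m; lra.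
Qed.

(** Write the chaos as [e L + A] and the linear form as [e x + B], where [e] is
    the first sign.  The only mixed term left by averaging over [e] is
    [4 x A L B].  Since [A] has mean zero, [L B] may be replaced there by
    [L B - m] with [m] its mean, and
    [4 x A (L B - m) <= 4 x^2 A^2 + (L B - m)^2]; with the variance bound and the
    induction hypothesis every product of second moments gets a coefficient at
    most [5]. *)
Lemma avg_chaos_lin n c b :
  avg n (fun s => chaos c s ^+ 2 * lin b s ^+ 2) <=
  5 * (avg n (fun s => chaos c s ^+ 2) * avg n (fun s => lin b s ^+ 2)).
Proof.
elim: n c b => [|n IH] c b; first by rewrite /= /lin /chaos !big_ord0; lra.
rewrite avg_chaos_sqrS !avg_lin_sqrS avgS.
set c' := shift2 c; set b' := shift b; set l := coupling c; set x := b 0%N.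
have {}IH := IH c' b'.
have := avg_lin_mul_var n l b'; have := avg_lin_sqr_mul n l b'.
have := avg_lin_CS n l b'.
move: (avg n (fun s => lin l s * lin b' s)) => m CS lb cov.
have step : avg n (fun s => (chaos c (1 :: s) ^+ 2 * lin b (1 :: s) ^+ 2 +
    chaos c (-1 :: s) ^+ 2 * lin b (-1 :: s) ^+ 2) / 2) <=
  avg n (fun s => chaos c' s ^+ 2 * lin b' s ^+ 2) +
  5 * x ^+ 2 * avg n (fun s => chaos c' s ^+ 2) +
  avg n (fun s => lin l s ^+ 2 * lin b' s ^+ 2) +
  x ^+ 2 * avg n (fun s => lin l s ^+ 2) +
  avg n (fun s => (lin l s * lin b' s - m) ^+ 2).
  (* The added mean of A is zero; it recentres the mixed term pointwise. *)
  have -> : avg n (fun s => (lin l s * lin b' s - m) ^+ 2) =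
     avg n (fun s => (lin l s * lin b' s - m) ^+ 2) + 4 * x * m * avg n (chaos c').
    by rewrite avg_chaos mulr0 addr0.
  rewrite -!avgZ -!avgD; apply: le_avg => s.
  rewrite !lin_cons !chaos_cons ?sqrN1 ?expr1n// -/c' -/b' -/l -/x.
  rewrite -subr_ge0.
  have := sqr_ge0 (2 * x * chaos c' s - (lin l s * lin b' s - m)).
  by congr (0 <= _); field.
apply: le_trans step _.
have L0 : 0 <= avg n (fun s => lin l s ^+ 2) by apply: avg_ge0 => s; exact: sqr_ge0.
have x0 := sqr_ge0 x.
move: IH CS lb cov L0 x0; set A := avg n (fun s => chaos c' s ^+ 2).
set L := avg n (fun s => lin l s ^+ 2); set B := avg n (fun s => lin b' s ^+ 2).
nra.
Qed.

(** The cross terms produced by the first sign have coefficient [6], and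
    [6 * 5 = 2 * 15] is the coefficient required by the square on the right. *)
Lemma avg_chaos_pow4 n c :
  avg n (fun s => chaos c s ^+ 4) <= 15 * avg n (fun s => chaos c s ^+ 2) ^+ 2.
Proof.
elim: n c => [|n IH] c; first by rewrite /= /chaos !big_ord0; lra.
rewrite avg_chaos_sqrS avgS.
set c' := shift2 c; set l := coupling c.
have {}IH := IH c'.
have cl := avg_chaos_lin n c' l.
have ll := avg_lin_sqr_mul n l l.
have -> : avg n (fun s => (chaos c (1 :: s) ^+ 4 + chaos c (-1 :: s) ^+ 4) / 2) =
  avg n (fun s => chaos c' s ^+ 4) +
  6 * avg n (fun s => chaos c' s ^+ 2 * lin l s ^+ 2) +
  avg n (fun s => lin l s ^+ 2 * lin l s ^+ 2).
  rewrite -!avgZ -!avgD; apply: eq_avg => s.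
  by rewrite !chaos_cons ?sqrN1 ?expr1n// -/c' -/l; field.
rewrite -[avg n (fun s => lin l s * lin l s)]/(avg n (fun s => lin l s ^+ 2)) in ll.
nra.
Qed.

End SignAverage.

(** * From the fourth moment to the probability of a sign *)

Section Tail.
Variable R : realType.

Lemma sqr_sqrt3 : Num.sqrt 3 ^+ 2 = 3 :> R.
Proof. by rewrite sqr_sqrtr. Qed.

Lemma le_sqrt3 : 173 / 100 <= Num.sqrt 3 :> R.
Proof.
have := sqr_sqrt3; have := sqrtr_ge0 (3 : R).
move: (Num.sqrt _) => q; nra.
Qed.

(** For [x <= 0] the quartic is maximal at [x = - z * w], with
    [z = (1 + sqrt 3) / 2] the positive root of [2 z^3 - 3 z - 1]; the constant
    is its value there, so the difference has the double root [- z * w].  For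
    [x > 0] the factor [(x - w)^2] shows that the quartic touches 0 at [w]: the
    coefficient of [x] is the smallest in absolute value that keeps it
    nonpositive. *)
Lemma quartic_le_indic (w x : R) : 0 < w ->
  - 2 * w ^+ 3 * x + 3 * w ^+ 2 * x ^+ 2 - x ^+ 4 <=
  (9 + 6 * Num.sqrt 3) / 4 * w ^+ 4 * (x <= 0)%R%:R.
Proof.
move=> w0; have q2 := sqr_sqrt3; have q1 := le_sqrt3.
move: (Num.sqrt _) q2 q1 => q q2 q1.
case: (leP x 0) => x0.
  pose z := (1 + q) / 2.
  have z2 : z ^+ 2 = z + 1 / 2.
    have -> : z ^+ 2 = (1 + 2 * q + q ^+ 2) / 4 by rewrite /z; field.
    by rewrite q2 /z; field.
  have -> : (9 + 6 * q) / 4 = 3 * z + 3 / 4 by rewrite /z; field.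
  have z1 : 1 <= z by rewrite /z; lra.
  rewrite mulr1 -subr_ge0.
  have -> : (3 * z + 3 / 4) * w ^+ 4 -
      (- 2 * w ^+ 3 * x + 3 * w ^+ 2 * x ^+ 2 - x ^+ 4) =
    (x + z * w) ^+ 2 * ((x - z * w) ^+ 2 + (2 * z - 2) * w ^+ 2).
    have z3 : z ^+ 3 = 3 / 2 * z + 1 / 2.
      by rewrite exprS z2 mulrDr -expr2 z2; field.
    have z4 : z ^+ 4 = 2 * z + 3 / 4.
      by rewrite exprS z3 mulrDr mulrCA -expr2 z2; field.
    transitivity (x ^+ 4 + (2 * z - 2 - 2 * z ^+ 2) * w ^+ 2 * x ^+ 2
      + (4 * z ^+ 2 - 4 * z) * w ^+ 3 * x
      + (z ^+ 4 + 2 * z ^+ 3 - 2 * z ^+ 2) * w ^+ 4); last by ring.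
    by rewrite z4 z3 z2; field.
  apply: mulr_ge0; first exact: sqr_ge0.
  by apply: addr_ge0; [exact: sqr_ge0 | apply: mulr_ge0; [lra|exact: sqr_ge0]].
rewrite mulr0.
have -> : - 2 * w ^+ 3 * x + 3 * w ^+ 2 * x ^+ 2 - x ^+ 4 =
  - (x * (x + 2 * w) * (x - w) ^+ 2) by ring.
rewrite oppr_le0; apply: mulr_ge0; last exact: sqr_ge0.
by apply: mulr_ge0; lra.
Qed.

(** A nonnegative function with zero average vanishes on all lists of [n] signs, but
    need not vanish on other lists; hence the recursion on [avg]. *)
Lemma le_avg_of_avg_eq0 n (f g : seq R -> R) (k : R) : (forall s, 0 <= f s) ->
  (forall s, f s = 0 -> k <= g s) -> avg n f = 0 -> k <= avg n g.
Proof.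
elim: n f g => [|n IH] f g f0 fg /=; first exact: fg.
set a := avg n _; set b := avg n _ => ab.
have a0 : 0 <= a by exact: avg_ge0.
have b0 : 0 <= b by exact: avg_ge0.
have {}a0 : a = 0 by lra.
have {}b0 : b = 0 by lra.
have ga := IH _ (fun s => g (1 :: s)) (fun s => f0 _) (fun s => @fg _) a0.
have gb := IH _ (fun s => g (-1 :: s)) (fun s => f0 _) (fun s => @fg _) b0.
lra.
Qed.

(** Fourth-moment method.  For a kurtosis bound [tau], the quartic of
    [quartic_le_indic] gives the best bound when [w^2 = 2 tau / 3] times the
    second moment, that is [10] times for [tau = 15]. *)
Lemma avg_fourth_moment n (f : seq R -> R) : avg n f = 0 ->
  avg n (fun s => f s ^+ 4) <= 15 * avg n (fun s => f s ^+ 2) ^+ 2 ->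
  (2 * Num.sqrt 3 - 3) / 15 <= avg n (fun s => (f s <= 0)%R%:R).
Proof.
move=> f1 f4; have q2 := sqr_sqrt3; have q1 := le_sqrt3.
set p := avg n (fun s => (f s <= 0)%R%:R).
set v := avg n (fun s => f s ^+ 2) in f4.
have v0 : 0 <= v by apply: avg_ge0 => s; exact: sqr_ge0.
have [v_eq0|v_neq0] := eqVneq v 0.
  apply: (@le_trans _ _ 1).
    by have : Num.sqrt 3 <= 2 :> R; [move: (Num.sqrt _) q2 q1 => q; nra | lra].
  apply: le_avg_of_avg_eq0 v_eq0 => s; first exact: sqr_ge0.
  by move/eqP; rewrite sqrf_eq0 => /eqP ->; rewrite lexx.
have {v0}v0 : 0 < v by rewrite lt_neqAle eq_sym v_neq0.
set w := Num.sqrt (10 * v).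
have w0 : 0 < w by rewrite sqrtr_gt0; lra.
have w2 : w ^+ 2 = 10 * v by rewrite sqr_sqrtr//; lra.
have : - 2 * w ^+ 3 * avg n f + 3 * w ^+ 2 * v + -1 * avg n (fun s => f s ^+ 4)
    <= (9 + 6 * Num.sqrt 3) / 4 * w ^+ 4 * p.
  rewrite -!avgZ -!avgD; apply: le_avg => s.
  by rewrite mulN1r; exact: quartic_le_indic.
have w4 : w ^+ 4 = (10 * v) ^+ 2 by rewrite -w2 -exprM.
rewrite f1 w2 w4.
move: (Num.sqrt 3) q2 q1 => q q2 q1 H.
have {}H : v ^+ 2 * 15 <= v ^+ 2 * ((9 + 6 * q) * 25 * p).
  have -> : v ^+ 2 * ((9 + 6 * q) * 25 * p) =
    (9 + 6 * q) / 4 * (10 * v) ^+ 2 * p by field.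
  apply: le_trans H; nra.
move: H; rewrite ler_pM2l ?exprn_gt0// => H.
(* 2 q - 3 rationalizes 9 + 6 q: (2 q - 3) (9 + 6 q) = 12 q^2 - 27 = 9. *)
have : (2 * q - 3) * 15 <= (2 * q - 3) * ((9 + 6 * q) * 25 * p).
  by apply: ler_wpM2l => //; lra.
have -> : (2 * q - 3) * ((9 + 6 * q) * 25 * p) = (12 * q ^+ 2 - 27) * 25 * p by ring.
rewrite q2; lra.
Qed.

End Tail.

(** * From sign lists to a Rademacher sequence *)

Section Signs.
Context d (T : measurableType d) (R : realType) (P : probability T R).
Variable r : nat -> {RV P >-> R}.
Hypothesis hr : rademacher_sequence r.

Definition cyl (u : seq R) : set T :=
  [set t | forall i, (i < size u)%N -> r i t = u`_i].

Lemma cylE u : cyl u =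
  \bigcap_(j in [set` [fset i | i in iota 0 (size u)]%fset])
     (r j @^-1` [set u`_j]).
Proof.
apply/seteqP; split => t /= h i.
  by rewrite /= !inE /= mem_iota => /h.
by move=> iu; apply: h; rewrite /= !inE /= mem_iota.
Qed.

Lemma measurable_cyl u : measurable (cyl u).
Proof.
rewrite cylE; apply: fin_bigcap_measurable; first exact: finite_fset.
by move=> i _; rewrite -[X in measurable X]setTI; exact: measurable_funP.
Qed.

Lemma prob_cyl u : {in u, forall x, x = 1 \/ x = -1} ->
  P (cyl u) = (2^-1 ^+ size u)%:E.
Proof.
case: hr => ind h1 hN1 hu; rewrite cylE ind; last by move=> j _.
rewrite (eq_big_seq (fun=> (2^-1 : R)%:E)); last first.
  move=> j; rewrite !inE /= mem_iota /= add0n => ju.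
  case: (hu _ (mem_nth 0 ju)) => ->.
    by rewrite -[LHS]/(P [set t | r j t = 1]) h1 div1r.
  by rewrite -[LHS]/(P [set t | r j t = -1]) hN1 div1r.
rewrite big_const_seq count_predT /=.
have -> : size [fset i | i in iota 0 (size u)]%fset = size u.
  by rewrite -[RHS](size_iota 0) card_imfset//= undup_id ?iota_uniq.
by elim: (size u) => //= m ->; rewrite -EFinM exprS.
Qed.

Lemma cyl_rcons u x : cyl (rcons u x) = cyl u `&` [set t | r (size u) t = x].
Proof.
apply/seteqP; split => t /=.
  move=> h; split.
    move=> i iu; have := h i; rewrite size_rcons nth_rcons iu.
    by apply; rewrite ltnW.
  by have := h (size u); rewrite size_rcons nth_rcons ltnn eqxx; apply.
move=> [h hx] i; rewrite size_rcons ltnS leq_eqVlt nth_rcons.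
by case/predU1P => [->|iu]; [rewrite ltnn eqxx | rewrite iu h].
Qed.

Lemma mkseq_cyl u t : cyl u t -> mkseq (r^~ t) (size u) = u.
Proof.
move=> h; apply: (@eq_from_nth _ 0); rewrite size_mkseq// => i iu.
by rewrite nth_mkseq// h.
Qed.

(** The sign lists of length [n] satisfying [Q] give disjoint events inside
    [Q], each of probability [2^-n].  Only this inequality holds without
    further argument, as the [r i] take values in [{1, -1}] almost surely
    rather than everywhere. *)
Lemma prob_ge_avg n (Q : pred (seq R)) :
  measurable [set t | Q (mkseq (r^~ t) n)] ->
  ((avg n (fun s => (Q s)%:R))%:E <= P [set t | Q (mkseq (r^~ t) n)])%E.
Proof.
move=> mQ; set E := [set t | _].
(* Induction on the number m of signs that the prefix u leaves undecided. *)
suff H m u : {in u, forall x, x = 1 \/ x = -1} -> (size u + m = n)%N ->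
   ((2^-1 ^+ size u * avg m (fun s => (Q (u ++ s))%:R))%:E <= P (E `&` cyl u))%E.
  have := H n [::] (fun x => ltac:(by rewrite in_nil)) erefl.
  rewrite expr0 mul1r => /le_trans; apply.
  apply: le_measure; rewrite ?inE//.
  by apply: measurableI => //; exact: measurable_cyl.
elim: m u => [|m IH] u hu.
  rewrite addn0 /= cats0 => un; case: (boolP (Q u)) => Qu; last first.
    by rewrite mulr0 measure_ge0.
  rewrite mulr1 -prob_cyl// (_ : E `&` cyl u = cyl u)//.
  by apply: setIidr => t ut; rewrite /E /= -un mkseq_cyl.
move=> un.
have sgn_rcons x : x = 1 \/ x = -1 -> {in rcons u x, forall y, y = 1 \/ y = -1}.
  by move=> hx y; rewrite mem_rcons inE => /predU1P[->//|/hu].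
have sz x : (size (rcons u x) + m = n)%N by rewrite size_rcons addSnnS.
have H1 := IH (rcons u 1) (sgn_rcons _ (or_introl erefl)) (sz _).
have HN1 := IH (rcons u (-1)) (sgn_rcons _ (or_intror erefl)) (sz _).
have mE x : measurable (E `&` cyl (rcons u x)).
  by apply: measurableI => //; exact: measurable_cyl.
apply: (@le_trans _ _ (P ((E `&` cyl (rcons u 1)) `|` (E `&` cyl (rcons u (-1)))))).
  rewrite measureU//; last first.
    rewrite -subset0 => t [[_]]; rewrite !cyl_rcons => -[_ /= ->] [_ [_ /= h]].
    by have : (1 : R) <> -1 by lra.
  apply: le_trans (leeD H1 HN1).
  rewrite -EFinD lee_fin /= !size_rcons.
  under eq_avg do rewrite -cat_rcons.
  under [X in (_ + X) / _]eq_avg do rewrite -cat_rcons.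
  by rewrite exprS; lra.
apply: le_measure; rewrite ?inE//.
- exact: measurableU.
- by apply: measurableI => //; exact: measurable_cyl.
- by move=> t [] []; rewrite cyl_rcons => ? [].
Qed.

Lemma measurable_chaos n (c : nat -> nat -> R) :
  measurable_fun setT (fun t => chaos c (mkseq (r^~ t) n)).
Proof.
rewrite /chaos.
under eq_fun do rewrite size_mkseq.
apply: measurable_sum => i; apply: measurable_sum => j.
under eq_fun do rewrite !nth_mkseq ?ltn_ord//.
apply: measurable_funM => //; apply: measurable_funB => //.
exact: measurable_funM.
Qed.

Lemma prob_chaos_le0 n (c : nat -> nat -> R) :
  (((2 * Num.sqrt 3 - 3) / 15)%:E <=
    P [set t | (\sum_(i < n) \sum_(j < n) c i j * (r i t * r j t) <=
       \sum_(i < n) c i i)%R])%E.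
Proof.
have -> : [set t | \sum_(i < n) \sum_(j < n) c i j * (r i t * r j t) <=
       \sum_(i < n) c i i] = [set t | chaos c (mkseq (r^~ t) n) <= 0].
  apply/funext => t /=; congr is_true; rewrite -subr_le0; congr (_ <= _).
  rewrite /chaos size_mkseq -sumrB; apply: eq_bigr => i _.
  under [RHS]eq_bigr => j _ do rewrite mulrBr.
  rewrite sumrB; congr (_ - _).
    by apply: eq_bigr => j _; rewrite !nth_mkseq.
  rewrite (bigD1 i)//= eqxx mulr1 big1 ?addr0// => j ji.
  by rewrite [i == j]eq_sym (negbTE ji) mulr0.
apply: le_trans (prob_ge_avg (Q := fun s => chaos c s <= 0) _).
  rewrite lee_fin; apply: avg_fourth_moment; first exact: avg_chaos.
  exact: avg_chaos_pow4.
have := @measurable_fun_ler _ _ _ setT _ (cst 0) (measurable_chaos n c) (measurable_cst _).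
by move=> /(_ measurableT [set true]); rewrite setTI; apply.
Qed.

Lemma prob_chaos_ge0 n (c : nat -> nat -> R) :
  (((2 * Num.sqrt 3 - 3) / 15)%:E <=
    P [set t | (\sum_(i < n) \sum_(j < n) c i j * (r i t * r j t) >=
       \sum_(i < n) c i i)%R])%E.
Proof.
have := prob_chaos_le0 n (fun i j => - c i j).
congr (_ <= P _)%E; apply/funext => t /=; congr is_true.
rewrite -[RHS]lerN2 -!sumrN; congr (_ <= _); apply: eq_bigr => i _.
by rewrite -sumrN; apply: eq_bigr => j _; rewrite mulNr.
Qed.

Lemma prob_quadratic n (c : 'I_n -> 'I_n -> R) : (0 < n)%N ->
  (((2 * Num.sqrt 3 - 3) / 15)%:E <=
    P [set t | (\sum_(i < n) \sum_(j < n) c i j * (r i t * r j t) <=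
       \sum_(i < n) c i i)%R])%E /\
  (((2 * Num.sqrt 3 - 3) / 15)%:E <=
    P [set t | (\sum_(i < n) \sum_(j < n) c i j * (r i t * r j t) >=
       \sum_(i < n) c i i)%R])%E.
Proof.
case: n c => // n c _; pose c' (i j : nat) := c (inord i) (inord j).
have c1 : \sum_(i < n.+1) c i i = \sum_(i < n.+1) c' i i.
  by apply: eq_bigr => i _; rewrite /c' inord_val.
have c2 t : \sum_(i < n.+1) \sum_(j < n.+1) c i j * (r i t * r j t) =
            \sum_(i < n.+1) \sum_(j < n.+1) c' i j * (r i t * r j t).
  by apply: eq_bigr => i _; apply: eq_bigr => j _; rewrite /c' !inord_val.
split.
  by under eq_set do rewrite c1 c2; exact: prob_chaos_le0.
by under eq_set do rewrite c1 c2; exact: prob_chaos_ge0.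
Qed.

(** * Hilbert spaces *)

(** Real and complex scalars are treated together: [theta] is the identity or the
    conjugation, and the coefficients [x i] are fixed by it. *)
Lemma norm_sum_sqr (K : numFieldType) (theta : {rmorphism K -> K})
    (H : normedModType K) (ip : {dot H for theta}) n (a : 'I_n -> H) (x : 'I_n -> K) :
  norm_induced_by ip -> (forall i, theta (x i) = x i) ->
  `|\sum_(i < n) x i *: a i| ^+ 2 =
  \sum_(i < n) \sum_(j < n) ip (a i) (a j) * (x i * x j).
Proof.
move=> ipE xR; rewrite ipE linear_sumlz; apply: eq_bigr => i _.
rewrite linear_sumr; apply: eq_bigr => j _.
by rewrite linearZl_LR linearZr_LR /= xR; ring.
Qed.

Lemma prob_real_hilbert (H : completeNormedModType R) (ip : {dot H for idfun}) :
  real_hilbert ip ->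
  forall (n : nat) (a : 'I_n -> H), (1 <= n)%N ->
    (((2 * Num.sqrt 3 - 3) / 15)%:E <=
       P [set t | (`|\sum_(i < n) r i t *: a i| <=
                   Num.sqrt (\sum_(i < n) `|a i| ^+ 2))%R])%E /\
    (((2 * Num.sqrt 3 - 3) / 15)%:E <=
       P [set t | (`|\sum_(i < n) r i t *: a i| >=
                   Num.sqrt (\sum_(i < n) `|a i| ^+ 2))%R])%E.
Proof.
move=> ipE n a n0.
have [] := prob_quadratic (fun i j => ip (a i) (a j)) n0.
have sqE t := norm_sum_sqr a (x := fun i : 'I_n => r i t) ipE (fun=> erefl).
have -> : \sum_(i < n) ip (a i) (a i) = \sum_(i < n) `|a i| ^+ 2.
  by apply: eq_bigr => i _; rewrite ipE.
have norm_sqrt (x : H) : `|x| = Num.sqrt (`|x| ^+ 2).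
  by rewrite sqrtr_sqr normr_id.
have sum0 : 0 <= \sum_(i < n) `|a i| ^+ 2.
  by apply: sumr_ge0 => i _; exact: sqr_ge0.
under eq_set do rewrite -sqE -ler_sqrt// -norm_sqrt.
move=> le_set.
under eq_set do rewrite -sqE -ler_sqrt ?sqr_ge0// -norm_sqrt.
by split.
Qed.

Lemma prob_complex_hilbert (H : completeNormedModType R[i])
    (ip : {dot H for (@Num.conj R[i])}) :
  complex_hilbert ip ->
  forall (n : nat) (a : 'I_n -> H), (1 <= n)%N ->
    (((2 * Num.sqrt 3 - 3) / 15)%:E <=
       P [set t | (`|\sum_(i < n) (r i t)%:C%C *: a i| <=
                   sqrtC (\sum_(i < n) `|a i| ^+ 2))%R])%E /\
    (((2 * Num.sqrt 3 - 3) / 15)%:E <=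
       P [set t | (`|\sum_(i < n) (r i t)%:C%C *: a i| >=
                   sqrtC (\sum_(i < n) `|a i| ^+ 2))%R])%E.
Proof.
move=> ipE n a n0.
have [] := prob_quadratic (fun i j => complex.Re (ip (a i) (a j))) n0.
have ReD (x y : R[i]) : complex.Re (x + y) = complex.Re x + complex.Re y.
  by case: x y => ? ? [].
have Re_sum := big_morph (@complex.Re R) ReD erefl.
have -> : \sum_(i < n) complex.Re (ip (a i) (a i)) =
    complex.Re (\sum_(i < n) `|a i| ^+ 2).
  by rewrite Re_sum; apply: eq_bigr => i _; rewrite ipE.
have sqE t : \sum_(i < n) \sum_(j < n) complex.Re (ip (a i) (a j)) * (r i t * r j t)
    = complex.Re (`|\sum_(i < n) (r i t)%:C%C *: a i| ^+ 2).
  rewrite (norm_sum_sqr _ ipE) => [|i]; last by apply/eqP; rewrite eq_complex /= oppr0 !eqxx.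
  rewrite Re_sum; apply: eq_bigr => i _; rewrite Re_sum; apply: eq_bigr => j _.
  by case: (ip _ _) => u v /=; ring.
have norm_sqrt (x : H) : `|x| = sqrtC (`|x| ^+ 2) by rewrite sqrCK.
have sqr_nneg (x : H) : `|x| ^+ 2 \is Num.nneg by rewrite nnegrE exprn_ge0.
have sum_nneg : \sum_(i < n) `|a i| ^+ 2 \is Num.nneg.
  by rewrite nnegrE; apply: sumr_ge0 => i _; rewrite exprn_ge0.
have leRe (x y : R[i]) : x \is Num.nneg -> y \is Num.nneg ->
    (complex.Re x <= complex.Re y) = (sqrtC x <= sqrtC y).
  by move=> x0 y0; rewrite ler_sqrtC// lecE !ger0_Im// eqxx.
under eq_set do rewrite sqE leRe// -norm_sqrt.
move=> le_set.
under eq_set do rewrite sqE leRe// -norm_sqrt.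
by split.
Qed.
End Signs.

Theorem corollary3p4 (R : realType) (d : measure_display)
    (T : measurableType d) (P : probability T R) (r : nat -> {RV P >-> R})
    (hr : rademacher_sequence r) :
  [/\ forall (H : completeNormedModType R) (ip : {dot H for idfun}),
        real_hilbert ip ->
        forall (n : nat) (a : 'I_n -> H), (1 <= n)%N ->
          (((2 * Num.sqrt 3 - 3) / 15)%:E <=
             P [set t | (`|\sum_(i < n) r i t *: a i| <=
                         Num.sqrt (\sum_(i < n) `|a i| ^+ 2))%R])%E /\
          (((2 * Num.sqrt 3 - 3) / 15)%:E <=
             P [set t | (`|\sum_(i < n) r i t *: a i| >=
                         Num.sqrt (\sum_(i < n) `|a i| ^+ 2))%R])%E,
      forall (H : completeNormedModType R[i])
          (ip : {dot H for (@Num.conj R[i])}),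
        complex_hilbert ip ->
        forall (n : nat) (a : 'I_n -> H), (1 <= n)%N ->
          (((2 * Num.sqrt 3 - 3) / 15)%:E <=
             P [set t | (`|\sum_(i < n) (r i t)%:C%C *: a i| <=
                         sqrtC (\sum_(i < n) `|a i| ^+ 2))%R])%E /\
          (((2 * Num.sqrt 3 - 3) / 15)%:E <=
             P [set t | (`|\sum_(i < n) (r i t)%:C%C *: a i| >=
                         sqrtC (\sum_(i < n) `|a i| ^+ 2))%R])%E &
      (2 * Num.sqrt 3 - 3) / 15 > 3 / 100 :> R].
Proof.
split; first exact: prob_real_hilbert.
  exact: prob_complex_hilbert.
by have := le_sqrt3 R; lra.
Qed.
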